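(* Let $G$ be a graph, $r\ge 1$ and $q\ge 1$ integers, and $X$ a set of vertices of $G$ pairwise at distance exactly $r$. Assume that no vertex of $G$ belongs to $q$ (or more) of the balls $B_G(x,\lceil r/2\rceil)$, $x\in X$. Then the distance VC-dimension of $G$ is at least $(\log_2|X|-\log_2(2q))/3$.
   Context: All graphs are finite and simple; $d_G$ is shortest-path distance and $B_G(x,k)=\{y: d_G(x,y)\le k\}$. The $B$-hypergraph of a graph $H$ has vertex set $V(H)$ and hyperedges all balls $B_H(v,k)$, $v\in V(H)$, $k\ge0$. A set $Y$ is shattered by a hypergraph if for every $Y'\subseteq Y$ some hyperedge $e$ satisfies $e\cap Y=Y'$; the VC-dimension is the maximum size of a shattered set. The distance VC-dimension of $G$ is the maximum over induced subgraphs $G'$ of $G$ of the VC-dimension of the $B$-hypergraph of $G'$ (distances computed in $G'$). *)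

(* Defs.v *)
(* A simple graph is a symmetric irreflexive relation [e] on a finType of
   vertices. *)
From HB Require Import structures.
From mathcomp Require Import all_boot all_order all_algebra.
From mathcomp Require Import boolp reals exp.

Set Implicit Arguments.
Unset Strict Implicit.
Unset Printing Implicit Defensive.

Section Distance.
Variables (T : finType) (e : rel T).

Definition walk (x y : T) (n : nat) : bool :=
  [exists p : n.-tuple T, path e x p && (last x p == y)].

(* [None] is the infinite distance between different components. *)
Definition gdist (x y : T) : option nat :=
  if pselect (exists n, walk x y n) is left h then Some (ex_minn h) else None.

Definition gball (x : T) (k : nat) : {set T} :=
  [set y | if gdist x y is Some d then d <= k else false].

(* [k] ranges over all of nat, hence the classical [`[< _ >]]. *)
Definition Bhypergraph : {set {set T}} :=
  [set B | `[< exists (v : T) (k : nat), B = gball v k >]].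

End Distance.

Section VCDimension.
Variables (T : finType) (E : {set {set T}}).

Definition shattered (Y : {set T}) : bool :=
  [forall Y' : {set T}, (Y' \subset Y) ==> [exists B in E, B :&: Y == Y']].

(* A hypergraph without hyperedges shatters nothing; its value here is 0. *)
Definition VCdim : nat := \max_(Y : {set T} | shattered Y) #|Y|.

End VCDimension.

Definition induced (T : finType) (e : rel T) (S : {set T}) :
  rel {x : T | x \in S} := relpre val e.

Definition distance_VCdim (T : finType) (e : rel T) : nat :=
  \max_(S : {set T}) VCdim (Bhypergraph (induced e (S := S))).

Definition log2 (R : realType) (x : R) : R := (ln x / ln 2)%R.

(* Main.v *)
(* Let [d] be one more than the distance VC-dimension and suppose that
   [#|X| > 8 ^ (d - 1) * 2q]. Index points [s A] of [X] by the subsets [A] of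
   ['I_d], and fix a shortest path between any two points of [X]. A third point
   of [X] is within [ceil (r/2)] of such a path only through one of its at most
   two middle vertices, so each path excludes at most [2 (q - 1)] values for
   each other point. By a union bound, [s] can be chosen such that the middle
   vertices of the path from [s A] to [s [set i]], for [i] in [A], avoid the
   balls of radius [ceil (r/2)] around all other [s B]. In the subgraph induced
   by these paths, the points [s [set i]] are shattered: for [#|A| > 1] and [i]
   not in [A], the middle of a walk of length [r] from [s A] to [s [set i]]
   would lie on a selected path and be close to both [s A] and [s [set i]], which
   forces these to be the ends of that path. *)
Require Import Defs.
From mathcomp Require Import all_boot all_order all_algebra.
From mathcomp Require Import boolp reals exp.
From mathcomp Require Import zify.
Import Order.TTheory GRing.Theory Num.Theory.

Set Implicit Arguments.
Unset Strict Implicit.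
Unset Printing Implicit Defensive.

(** * A union bound over functions with values in a fixed set *)

Section Counting.
Variables (I C T : finType).

Definition upd (f : {ffun I -> T}) (k : I) (x : T) : {ffun I -> T} :=
  [ffun i => if i == k then x else f i].

Lemma upd_on (X : {set T}) f k x :
  f \in ffun_on X -> x \in X -> upd f k x \in ffun_on X.
Proof.
by move=> /ffun_onP fX xX; apply/ffun_onP=> i; rewrite ffunE; case: ifP.
Qed.

Lemma updK f k x : upd (upd f k x) k (f k) = f.
Proof. by apply/ffunP=> i; rewrite !ffunE; case: eqP => [->|]. Qed.

Lemma upd_id f k x : upd f k x k = x.
Proof. by rewrite ffunE eqxx. Qed.

(** Swapping [x] with the value of [f] at [k] is an involution on pairs [(f, x)]. It matches the
    pairs with [f] bad to those with [upd f k x] bad, and each [f] has at most [m] of the latter. *)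
Lemma card_ffun_fiber (X : {set T}) (k : I) (bad : pred {ffun I -> T}) m :
    (forall f, f \in ffun_on X -> #|[set x in X | bad (upd f k x)]| <= m) ->
  #|[set f in ffun_on X | bad f]| * #|X| <= m * #|X| ^ #|I|.
Proof.
move=> le_m; rewrite -card_ffun_on -cardsX -sum1_card.
pose h (p : {ffun I -> T} * T) := (upd p.1 k p.2, p.1 k).
have hK : involutive h by case=> f x; rewrite /h /= updK upd_id.
rewrite (reindex_inj (inv_inj hK)) /=.
rewrite (eq_bigl (fun p => (p.1 \in ffun_on X) &&
  (p.2 \in [set x in X | bad (upd p.1 k x)]))); last first.
  case=> f x /=; rewrite !in_set /=.
  apply/idP/idP => [/andP[/andP[fX ->] fkX]|/and3P[fX xX ->]].
    by rewrite -{1}(updK f k x) upd_on //= andbT -(upd_id f k x) (ffun_onP fX).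
  by rewrite upd_on // (ffun_onP fX).
rewrite -(pair_big_dep (mem (ffun_on X))
  (fun f x => x \in [set x in X | bad (upd f k x)]) (fun _ _ => 1)) /=.
rewrite mulnC -sum_nat_const leq_sum // => f fX.
by rewrite sum1_card le_m.
Qed.

(** Resampling the coordinate [kappa c] shows that at most a fraction [m / #|X|] of the functions is
    bad for [c]; over all [c] in [P] these fractions add up to less than 1. *)
Lemma avoid_bad (X : {set T}) (P : {pred C}) (kappa : C -> I)
    (bad : C -> pred {ffun I -> T}) m :
    (forall c f, c \in P -> f \in ffun_on X ->
       #|[set x in X | bad c (upd f (kappa c) x)]| <= m) ->
    #|P| * m < #|X| ->
  exists2 f : {ffun I -> T}, f \in ffun_on X & forall c, c \in P -> ~~ bad c f.
Proof.
move=> le_m lt_X; have X_gt0 : 0 < #|X| by apply: leq_ltn_trans lt_X.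
case: (boolP [exists f in ffun_on X, [forall c in P, ~~ bad c f]]).
  by case/exists_inP=> f fX /forall_inP; exists f.
rewrite negb_exists => /forallP all_bad; exfalso.
have: #|X| ^ #|I| * #|X| <= #|P| * m * #|X| ^ #|I|.
  apply: (@leq_trans
    ((\sum_(c in P) #|[set f in ffun_on X | bad c f]|) * #|X|)).
    rewrite leq_mul2r -card_ffun_on; apply/orP; right.
    rewrite (eq_bigr (fun c => \sum_(f in ffun_on X) bad c f)); last first.
      by move=> c _; rewrite -sum1_card big_mkcond [RHS]big_mkcond;
         apply: eq_bigr => f _; rewrite inE; case: (f \in _); case: (bad c f).
    rewrite exchange_big -sum1_card; apply: leq_sum => f fX.
    have := all_bad f; rewrite negb_and fX /= negb_forall => /existsP[c].
    rewrite negb_imply negbK => /andP[cP bf].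
    by rewrite (bigD1 c) //= bf.
  rewrite big_distrl -mulnA -sum_nat_const; apply: leq_sum => c cP.
  by apply: (@card_ffun_fiber _ (kappa c)) => f fX; apply: le_m.
rewrite mulnC leq_pmul2r ?expn_gt0 ?X_gt0 //; lia.
Qed.

End Counting.

(** * Walks, distances and balls *)

Section Walks.
Variables (T : finType) (e : rel T).

Lemma walkP x y n :
  reflect (exists p, [/\ path e x p, last x p = y & size p = n]) (walk e x y n).
Proof.
apply: (iffP existsP) => [[p /andP[px /eqP pl]]|[p [px pl sp]]].
  by exists p; rewrite size_tuple.
have sp' : size p == n by apply/eqP.
by exists (Tuple sp'); rewrite /= px pl eqxx.
Qed.

Lemma walk_cat x y z m n : walk e x y m -> walk e y z n -> walk e x z (m + n).
Proof.
move=> /walkP[p [px pl <-]] /walkP[p' [px' pl' <-]]; apply/walkP.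
by exists (p ++ p'); rewrite cat_path last_cat size_cat px pl px'.
Qed.

Lemma walk_sym x y n : symmetric e -> walk e x y n -> walk e y x n.
Proof.
move=> e_sym /walkP[p [px pl <-]]; apply/walkP; exists (rev (belast x p)).
rewrite size_rev size_belast -pl rev_path; split=> //.
  by rewrite (eq_path (e' := e)) // => u v; rewrite e_sym.
by case: p {px pl} => //= u p; rewrite rev_cons last_rcons.
Qed.

Lemma walk_nth {x p} i : path e x p -> i <= size p ->
  walk e x (nth x (x :: p) i) i
  /\ walk e (nth x (x :: p) i) (last x p) (size p - i).
Proof.
move=> px le_i; have := px; rewrite -{1}(cat_take_drop i p) cat_path.
have -> : nth x (x :: p) i = last x (take i p).
  by rewrite (last_nth x) size_takel // -(take_cons i.+1) ?nth_take.
case/andP=> p1 p2; split; apply/walkP.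
  by exists (take i p); rewrite size_takel.
by exists (drop i p); rewrite size_drop -last_cat cat_take_drop.
Qed.

Lemma gballP x k y :
  reflect (exists2 n, n <= k & walk e x y n) (y \in gball e x k).
Proof.
rewrite inE /gdist; case: pselect => [h|no_walk].
  case: ex_minnP => m wm m_min; apply: (iffP idP) => [|[n le_n wn]].
    by exists m.
  exact: leq_trans (m_min _ wn) le_n.
by apply: (iffP idP) => // -[n _ wn]; case: no_walk; exists n.
Qed.

Lemma gball_walk x k n y : n <= k -> walk e x y n -> y \in gball e x k.
Proof. by move=> le_n w; apply/gballP; exists n. Qed.

Lemma gball0 x y : (y \in gball e x 0) = (y == x).
Proof.
apply/gballP/eqP => [[n]|->]; last by exists 0 => //; apply/walkP; exists [::].
by rewrite leqn0 => /eqP-> /walkP[p [_ <- /size0nil->]].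
Qed.

Lemma gdist_walk x y r : gdist e x y = Some r -> walk e x y r.
Proof.
by rewrite /gdist; case: pselect => // h; case: ex_minnP => m ? _ [<-].
Qed.

Lemma gdist_min x y r n : gdist e x y = Some r -> walk e x y n -> r <= n.
Proof.
rewrite /gdist; case: pselect => // h.
by case: ex_minnP => m _ m_min [<-] /m_min.
Qed.

End Walks.

(** * Induced subgraphs and shattering by balls *)

Section Balls.
Variables (T : finType) (e : rel T).

Lemma walk_induced (S : {set T}) (u v : {x : T | x \in S}) n :
  walk (induced e (S := S)) u v n ->
  exists p, [/\ path e (val u) p, last (val u) p = val v, size p = n
              & {subset val u :: p <= S}].
Proof.
case/walkP=> p [pu pl <-]; exists (map val p).
rewrite size_map last_map pl path_map pu; split=> // w.
by rewrite -map_cons => /mapP[x _ ->]; apply: valP.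
Qed.

Lemma induced_walk (S : {set T}) (u v : {x : T | x \in S}) p :
  path e (val u) p -> last (val u) p = val v -> {subset p <= S} ->
  walk (induced e (S := S)) u v (size p).
Proof.
move=> pu pl /allP pS; apply/walkP.
exists (pmap insub p : seq {x : T | x \in S}).
have mapK : map val (pmap insub p : seq {x : T | x \in S}) = p.
  rewrite (pmap_filter (insubK _)); apply/all_filterP.
  by apply: sub_all pS => x xS; rewrite isSome_insub.
split; first by rewrite -mapK path_map in pu.
  by apply: val_inj; rewrite -last_map mapK.
by rewrite -{2}mapK size_map.
Qed.

Lemma VCdim_Bhypergraph_ge d (sigma : 'I_d -> T) :
    injective sigma ->
    (forall A : {set 'I_d},
       exists v k, forall i, (sigma i \in gball e v k) = (i \in A)) ->
  d <= VCdim (Bhypergraph e).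
Proof.
move=> sigma_inj traces.
have <- : #|sigma @: setT| = d by rewrite card_imset // cardsT card_ord.
apply: (@leq_bigmax_cond _ _ (fun Y : {set T} => #|Y|)).
apply/forallP=> Y'; apply/implyP=> /subsetP sub.
have [v [k vk]] := traces (sigma @^-1: Y').
apply/exists_inP; exists (gball e v k).
  by rewrite inE; apply/asboolP; exists v, k.
apply/eqP/setP=> x; rewrite in_setI; apply/andP/idP.
  by case=> xB /imsetP[i _ xi]; move: xB; rewrite xi vk inE.
by move=> xY'; have /imsetP[i _ xi] := sub x xY'; rewrite xi vk inE -xi sub.
Qed.

End Balls.

Lemma distance_VCdim_ge (T : finType) (e : rel T) (S : {set T}) d :
  d <= VCdim (Bhypergraph (induced e (S := S))) -> d <= distance_VCdim e.
Proof.
move=> le_d; apply: (leq_trans le_d).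
by rewrite /distance_VCdim (bigD1 S) //= leq_maxl.
Qed.

(** * Counting the constraints on the chosen points *)

Lemma leq_triples d : 0 < d ->
  d * ((2 ^ d.-1).-1 * (2 ^ d - 2)) <= 8 ^ d.-1.
Proof.
case: d => // a _; rewrite /= expnS.
(* With [2 ^ a = u + 1] the left side is [2 * (a + 1) * u ^ 2]. The estimate [2 * (a + 1) <= 2 ^ a]
   starts at [a = 3]; smaller cases are computed. *)
case: (ltnP a 3) => [|a_ge3]; first by case: a => [|[|[|]]].
have : 2 * a.+1 <= 2 ^ a.
  elim: a a_ge3 => // a IHa; rewrite leq_eqVlt => /orP[/eqP<- //|/IHa].
  rewrite expnS; lia.
have -> : 8 ^ a = (2 ^ a) ^ 3 by rewrite -expnM mulnC expnM.
case: (2 ^ a) => // u le_u; rewrite /= !expnS expn0 muln1.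
have -> : 2 * u.+1 - 2 = 2 * u by lia.
apply: (@leq_trans (u * u * (2 * a.+1))); first by lia.
by rewrite [leqRHS]mulnA; apply: leq_mul => //; apply: leq_mul.
Qed.

(** A triple [(i, A, B)] stands for the demand that [s B] stay clear of the middle of the path from
    [s A] to [s [set i]]. The factors count the choices of [i], then [A], then [B]. *)
Lemma card_triples d : 0 < d ->
  #|[pred c : 'I_d * {set 'I_d} * {set 'I_d} |
      (c.1.1 \in c.1.2) && (c.1.2 != [set c.1.1])
      && ((c.2 != c.1.2) && (c.2 != [set c.1.1]))]|
  = d * ((2 ^ d.-1).-1 * (2 ^ d - 2)).
Proof.
move=> d_gt0; rewrite -sum1_card -(pair_big_dep
  (fun p : 'I_d * {set 'I_d} => (p.1 \in p.2) && (p.2 != [set p.1]))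
  (fun p B => (B != p.2) && (B != [set p.1])) (fun _ _ => 1)) /=.
have card_sets : #|{: {set 'I_d}}| = 2 ^ d.
  by rewrite -cardsT -powersetT card_powerset cardsT card_ord.
rewrite (eq_bigr (fun _ => 2 ^ d - 2)); last first.
  move=> p /andP[_ pA]; rewrite sum1_card -card_sets.
  rewrite -(cardsC [set p.2; [set p.1]]) cards2 pA addKn; apply: eq_card => B.
  by rewrite !inE negb_or.
rewrite -(pair_big_dep xpredT
  (fun i (A : {set 'I_d}) => (i \in A) && (A != [set i]))
  (fun _ _ => 2 ^ d - 2)) /=.
rewrite (eq_bigr (fun _ => (2 ^ d.-1).-1 * (2 ^ d - 2))).
  by rewrite sum_nat_const card_ord.
move=> i _; rewrite sum_nat_const; congr (_ * _).
have cardC : #|~: powerset (~: [set i])| = 2 ^ d.-1.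
  rewrite cardsCs setCK card_powerset card_sets cardsC1 card_ord.
  by case: d d_gt0 {i card_sets} => //= a _; rewrite expnS; lia.
rewrite -cardC (cardsD1 [set i]) in_setC powersetE sub1set !inE eqxx /=.
apply: eq_card => A.
by rewrite !inE subsetC sub1set inE negbK andbC.
Qed.

(** * Shortest paths between points of [X], and the shattered set *)

Section Paths.
Variables (T : finType) (e : rel T) (e_sym : symmetric e) (r q : nat).
Variable X : {set T}.
Hypothesis X_dist : {in X &, forall x y : T, x != y -> gdist e x y = Some r}.
Hypothesis X_balls :
  forall v : T, #|[set x in X | v \in gball e x (uphalf r)]| < q.

(** For distinct [a] and [b] in [X] this is a shortest path, [r] being their distance; the default
    [[::]] can occur only for other pairs. *)
Definition spath (a b : T) : seq T :=
  if [pick p : r.-tuple T | path e a p && (last a p == b)] is Some p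
  then p else [::].

(** The two positions are the middle of a path of length [r]; they coincide for even [r]. *)
Definition conflict (a b c : T) : bool :=
  (nth a (a :: spath a b) r./2 \in gball e c (uphalf r))
  || (nth a (a :: spath a b) (uphalf r) \in gball e c (uphalf r)).

Lemma spathP a b : a \in X -> b \in X -> a != b ->
  [/\ path e a (spath a b), last a (spath a b) = b & size (spath a b) = r].
Proof.
move=> aX bX neq; rewrite /spath; case: pickP => [p /andP[pa /eqP pl]|no_p].
  by rewrite size_tuple.
have /existsP[p pab] := gdist_walk (X_dist aX bX neq).
by rewrite no_p in pab.
Qed.

(** Since the ends conflict with their own path, a point of [X] without conflict differs from both;
    this later separates the chosen points. *)
Lemma conflict_l a b : conflict a b a.
Proof.
apply/orP; left; rewrite /spath; case: pickP => [p /andP[pa _]|_].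
  have le_r : r./2 <= size p by rewrite size_tuple; lia.
  by apply: gball_walk (walk_nth pa le_r).1; lia.
have -> : nth a [:: a] r./2 = a by case: r./2 => // -[].
by apply: (@gball_walk _ _ _ _ 0) => //; apply/walkP; exists [::].
Qed.

Lemma conflict_r a b : a \in X -> b \in X -> conflict a b b.
Proof.
move=> aX bX; have [->|neq] := eqVneq a b; first exact: conflict_l.
have [pa pl sp] := spathP aX bX neq.
have le_r : r./2 <= size (spath a b) by lia.
apply/orP; left; have := (walk_nth pa le_r).2; rewrite pl sp.
by move/(walk_sym e_sym); apply: gball_walk; lia.
Qed.

Lemma card_conflict a b : #|[set c in X | conflict a b c]| <= q.-1.*2.
Proof.
set u := nth a (a :: spath a b) r./2.
set v := nth a (a :: spath a b) (uphalf r).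
have -> : [set c in X | conflict a b c] =
   [set x in X | u \in gball e x (uphalf r)]
   :|: [set x in X | v \in gball e x (uphalf r)].
  by apply/setP=> c; rewrite !in_set /conflict !in_set -andb_orr.
have := X_balls u; have := X_balls v.
have [+ _] := leq_card_setU [set x in X | u \in gball e x (uphalf r)]
   [set x in X | v \in gball e x (uphalf r)].
lia.
Qed.

(* A vertex of the path at distance [i] from [a] and within [ceil (r/2)] of a
   third point is at distance at least [floor (r/2)] from both [a] and [b], so
   it is one of the at most two middle vertices. *)
Lemma near_conflict a b c w :
    a \in X -> b \in X -> c \in X -> a != b ->
    w \in a :: spath a b -> w \in gball e c (uphalf r) ->
  conflict a b c.
Proof.
move=> aX bX cX neq wP wc.
have [->|nca] := eqVneq c a; first exact: conflict_l.
have [->|ncb] := eqVneq c b; first exact: conflict_r.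
have [pa pl sp] := spathP aX bX neq.
have lt_i : index w (a :: spath a b) <= size (spath a b).
  by rewrite -ltnS -[(size _).+1]/(size (a :: spath a b)) index_mem.
have [] := walk_nth pa lt_i; have := nth_index a wP; rewrite /conflict.
set i := index _ _ in lt_i *; move=> wi; rewrite wi pl sp => aw wb.
have [n le_n cw] := gballP _ _ _ _ wc.
have := gdist_min (X_dist cX bX ncb) (walk_cat cw wb).
have := gdist_min (X_dist cX aX nca) (walk_cat cw (walk_sym e_sym aw)).
move=> le1 le2.
have [ri|ri] : i = r./2 \/ i = uphalf r.
  by rewrite sp in lt_i; clear -lt_i le_n le1 le2; lia.
  by rewrite -ri wi wc.
by move: wi; rewrite ri => ->; rewrite wc orbT.
Qed.

Lemma choose_points d : 0 < d -> 8 ^ d.-1 * (2 * q) < #|X| ->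
  exists2 s : {set 'I_d} -> T, (forall A, s A \in X) &
    forall (A B : {set 'I_d}) i,
      i \in A -> A != [set i] -> B != A -> B != [set i] ->
      ~~ conflict (s A) (s [set i]) (s B).
Proof.
move=> d_gt0 ltX.
pose P := [pred c : 'I_d * {set 'I_d} * {set 'I_d} |
      (c.1.1 \in c.1.2) && (c.1.2 != [set c.1.1])
      && ((c.2 != c.1.2) && (c.2 != [set c.1.1]))].
pose bad (c : 'I_d * {set 'I_d} * {set 'I_d}) (f : {ffun {set 'I_d} -> T}) :=
  conflict (f c.1.2) (f [set c.1.1]) (f c.2).
(* The value at [B] is resampled: [B] is neither [A] nor [[set i]], so the path stays fixed and
   [card_conflict] applies. *)
have [||s sX s_ok] := @avoid_bad _ _ _ X P (fun c => c.2) bad q.-1.*2.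
- move=> [[i A] B] f /andP[_ /= /andP[/negPf BA /negPf Bi]] _.
  apply: leq_trans (card_conflict (f A) (f [set i])).
  apply: subset_leq_card; apply/subsetP=> x.
  by rewrite !in_set /bad /= !ffunE eqxx eq_sym BA eq_sym Bi.
- apply: leq_ltn_trans ltX; rewrite card_triples //.
  by apply: leq_mul; [apply: leq_triples | lia].
exists s => [A|A B i iA Ai BA Bi]; first exact: (ffun_onP sX).
by apply: (s_ok (i, A, B)); rewrite inE /= iA Ai BA Bi.
Qed.

Lemma distance_VCdim_large d : 1 < d -> 8 ^ d.-1 * (2 * q) < #|X| ->
  d <= distance_VCdim e.
Proof.
move=> d_gt1 ltX; have [|s sX s_ok] := choose_points _ ltX; first exact: ltnW.
(* If [A = [set i]], the path from [s [set i; j]] to [s [set i]] has no conflict with [s [set j]]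
   but has one with its end. Otherwise the path from [s A] to [s [set i]] serves likewise, through
   its start. *)
have s_neq (A : {set 'I_d}) i j : i \in A -> i != j -> s A != s [set j].
  move=> iA ij; have [Ai|Ai] := eqVneq A [set i].
    rewrite Ai; apply: contraTneq isT => sij.
    have iB : i \in [set i; j] by rewrite !inE eqxx.
    have Bi : [set i; j] != [set i].
      by apply/eqP=> /setP/(_ j); rewrite !inE eqxx orbT eq_sym (negPf ij).
    have jB : [set j] != [set i; j].
      by apply/eqP=> /setP/(_ i); rewrite !inE eqxx (negPf ij).
    have ji : [set j] != [set i].
      by apply/eqP=> /setP/(_ i); rewrite !inE eqxx (negPf ij).
    by have := s_ok _ _ _ iB Bi jB ji; rewrite -sij conflict_r.
  have [Aj|Aj] := eqVneq A [set j].
    by move: iA; rewrite Aj inE (negPf ij).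
  apply: contraTneq isT => sAj.
  have := s_ok _ [set j] _ iA Ai; rewrite eq_sym Aj -sAj conflict_l; apply=> //.
  by apply/eqP=> /setP/(_ i); rewrite !inE eqxx (negPf ij).
have s_neq' (A : {set 'I_d}) i : A != set0 -> A != [set i] -> s A != s [set i].
  case/set0Pn=> j jA Ai; have [ji|/(s_neq _ _ _ jA)//] := eqVneq j i.
  have /subsetPn[k kA] : ~~ (A \subset [set i]).
    by apply: contra Ai => Asub; rewrite eqEsubset Asub sub1set -ji.
  by rewrite inE; apply: s_neq.
pose S := [set w | [exists A : {set 'I_d}, [exists i : 'I_d,
   [&& i \in A, A != [set i] & w \in s A :: spath (s A) (s [set i])]]]].
have pathS (A : {set 'I_d}) i : i \in A -> A != [set i] ->
    {subset s A :: spath (s A) (s [set i]) <= S}.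
  move=> iA Ai w wP; rewrite inE; apply/existsP; exists A; apply/existsP.
  by exists i; rewrite iA Ai.
have AneqS (A : {set 'I_d}) : 1 < #|A| -> forall i, A != [set i].
  by move=> A_gt1 i; apply: contraTneq A_gt1 => ->; rewrite cards1.
have nonempty (A : {set 'I_d}) : 1 < #|A| -> A != set0.
  by move=> A_gt1; rewrite -card_gt0 ltnW.
have sAS (A : {set 'I_d}) : 1 < #|A| -> s A \in S.
  move=> A_gt1; have /set0Pn[i iA] := nonempty A A_gt1.
  by apply: (pathS A i iA (AneqS _ A_gt1 i)); apply: mem_head.
(* Here [1 < d] enters: the paths from [s setT] bring every [s [set i]] into [S]. *)
have setT_gt1 : 1 < #|[set: 'I_d]| by rewrite cardsT card_ord.
have siS i : s [set i] \in S.
  have [|_ <- _] := @spathP (s setT) (s [set i]) (sX _) (sX _).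
    by apply: s_neq'; [apply: nonempty | apply: AneqS].
  exact: (pathS setT i (in_setT i) (AneqS _ setT_gt1 i) _ (mem_last _ _)).
apply: (@distance_VCdim_ge _ _ S).
pose sigma i : {x : T | x \in S} := Sub (s [set i]) (siS i).
apply: (@VCdim_Bhypergraph_ge _ _ _ sigma).
  move=> i j /(congr1 val) /= sij; apply/eqP; apply: contraT => ij.
  by have := s_neq [set i] i j (set11 i) ij; rewrite sij eqxx.
move=> A; have [A_gt1|] := ltnP 1 #|A|; last first.
  (* Traces of size at most 1 come from balls of radius 0, around the point itself or, for the empty
     trace, around [s setT]. *)
  rewrite leq_eqVlt ltnS leqn0 => /orP[/cards1P[j ->]|/eqP/cards0_eq->].
    exists (sigma j), 0 => i; rewrite gball0 inE; apply/eqP/eqP=> [|->] //.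
    move/(congr1 val) => /= sij; apply/eqP; apply: contraT => ij.
    by have := s_neq [set i] i j (set11 i) ij; rewrite sij eqxx.
  exists (Sub (s setT) (sAS _ setT_gt1)), 0 => i; rewrite gball0 inE.
  apply/eqP=> /(congr1 val) /= /esym/eqP; apply/negP.
  by apply: s_neq'; [apply: nonempty | apply: AneqS].
exists (Sub (s A) (sAS A A_gt1)), r => i.
have Ai := AneqS A A_gt1 i; have neq := s_neq' A i (nonempty A A_gt1) Ai.
apply/idP/idP => [/gballP[n le_n]|iA]; last first.
  have [pa pl sp] := spathP (sX A) (sX [set i]) neq.
  apply: (@gball_walk _ _ _ _ r) => //; rewrite -sp.
  apply: induced_walk => // w wP.
  by apply: (pathS A i iA Ai); rewrite inE wP orbT.
case/walk_induced=> p [pA pl sp pS]; rewrite /= in pA pl pS.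
(* A walk inside [S] is a walk of the whole graph, so it cannot be shorter than [r]. *)
have nr : n = r.
  apply/eqP; rewrite eqn_leq le_n -sp.
  apply: (gdist_min (X_dist (sX A) (sX [set i]) neq)); apply/walkP.
  by exists p.
have le_r : r./2 <= size p by lia.
have [] := walk_nth pA le_r; set w := nth _ _ _ => Aw; rewrite pl sp nr.
move/(walk_sym e_sym) => iw.
have wA : w \in gball e (s A) (uphalf r) by apply: gball_walk Aw; lia.
have wi : w \in gball e (s [set i]) (uphalf r) by apply: gball_walk iw; lia.
have: w \in S by apply/pS/mem_nth; rewrite /=; lia.
rewrite inE => /existsP[B /existsP[j /and3P[jB Bj wP]]].
have Bneq : s B != s [set j].
  by apply: s_neq' => //; apply/set0Pn; exists j.
have near C : w \in gball e (s C) (uphalf r) -> C = B \/ C = [set j].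
  move=> wC; have [->|CB] := eqVneq C B; first by left.
  have [->|Cj] := eqVneq C [set j]; first by right.
  by have := s_ok _ _ _ jB Bj CB Cj; rewrite (near_conflict _ _ _ Bneq wP wC).
(* As [A] is not a singleton, [A = B]; then [[set i]] is not [B], so [i = j], which lies in
   [B = A]. *)
have [AB|Aj] := near _ wA; last by have := AneqS A A_gt1 j; rewrite Aj eqxx.
have [iB|/set1_inj->] := near _ wi; last by rewrite AB.
by rewrite AB -iB eqxx in Ai.
Qed.

End Paths.

(** * The logarithmic bound *)

Lemma distance_VCdim_gt0 (T : finType) (e : rel T) : 1 < #|T| ->
  0 < distance_VCdim e.
Proof.
move=> T_gt1; apply: (@distance_VCdim_ge _ _ setT).
have /card_gt1P[x [y [_ _ xy]]] : 1 < #|[set: T]| by rewrite cardsT.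
pose u : {x : T | x \in [set: T]} := Sub x (in_setT x).
pose v : {x : T | x \in [set: T]} := Sub y (in_setT y).
apply: (@VCdim_Bhypergraph_ge _ _ _ (fun _ : 'I_1 => u)).
  by move=> i j _; rewrite !ord1.
move=> A; have [A0|A0] := boolP (ord0 \in A).
  by exists u, 0 => i; rewrite gball0 eqxx ord1 A0.
exists v, 0 => i; rewrite gball0 ord1 (negPf A0); apply/eqP.
by move/(congr1 val)/eqP; rewrite /= (negPf xy).
Qed.

Theorem theorem17 (R : realType) (T : finType) (e : rel T)
    (e_sym : symmetric e) (e_irr : irreflexive e)
    (r q : nat) (r_ge1 : (1 <= r)%N) (q_ge1 : (1 <= q)%N)
    (X : {set T})
    (X_dist : {in X &, forall x y : T, x != y -> gdist e x y = Some r})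
    (X_balls : forall v : T, (#|[set x in X | v \in gball e x (uphalf r)]| < q)%N) :
  (((log2 (#|X|%:R : R) - log2 ((2 * q)%N%:R : R)) / 3)
     <= ((distance_VCdim e)%:R : R))%R.
Proof.
(* [distance_VCdim_large] needs [1 < d], so dimension 0 is excluded separately: there [X] would have
   more than [2 * q] points. *)
have leX : #|X| <= 8 ^ distance_VCdim e * (2 * q).
  rewrite leqNgt; apply/negP=> ltX.
  have [D0|D_gt0] := posnP (distance_VCdim e); last first.
    have := distance_VCdim_large e_sym X_dist X_balls
              (d := (distance_VCdim e).+1) D_gt0 ltX.
    by rewrite ltnn.
  suff: 0 < distance_VCdim e by rewrite D0.
  apply: distance_VCdim_gt0; apply: (@leq_trans #|X|); last exact: max_card.
  by move: ltX; rewrite D0 expn0; lia.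
set D := distance_VCdim e in leX *.
have ln2_gt0 : (0 < ln 2 :> R)%R by rewrite ln_gt0 ?ltr1n.
have q2_gt0 : (0 < (2 * q)%N%:R :> R)%R by rewrite ltr0n muln_gt0.
rewrite ler_pdivrMr ?ltr0n // /log2 -mulrBl ler_pdivrMr //.
(* For empty [X] the convention [ln 0 = 0] makes the left side nonpositive. *)
have [X0|X_gt0] := posnP #|X|.
  rewrite X0 ln0 // sub0r; apply: (@le_trans _ _ 0%R).
    by rewrite oppr_le0 ln_ge0 // ler1n muln_gt0.
  by rewrite !mulr_ge0 ?ler0n // ltW.
rewrite lerBlDr.
(* The divisor 3 comes from [8 = 2 ^ 3]. *)
have -> : (D%:R * 3 * ln 2 + ln (2 * q)%N%:R)%R
         = ln ((8 ^ D * (2 * q))%N%:R : R).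
  rewrite (natrM _ (8 ^ D)) lnM ?posrE ?ltr0n ?expn_gt0 ?muln_gt0 //.
  have -> : (8 ^ D = 2 ^ (D * 3))%N by rewrite mulnC expnM.
  by rewrite natrX lnXn ?ltr0n // -[(ln 2 *+ _)%R]mulr_natl (natrM _ D).
by rewrite ler_ln ?posrE ?ltr0n ?muln_gt0 ?expn_gt0 // ler_nat.
Qed.
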